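(* Let $\mathcal{C}$ be a category and let $J_1,J_2$ be Grothendieck topologies on $\mathcal{C}$. For each object $c$ of $\mathcal{C}$ let $(J_1\Rightarrow J_2)(c)$ be the collection of all sieves $S$ on $c$ such that for any arrow $f:d\to c$ and any sieve $Z$ on $d$, if $Z$ is $J_1$-covering and $J_2$-closed and $f^{*}(S)\subseteq Z$, then $Z=M_d$. Then $J_1\Rightarrow J_2$ is a Grothendieck topology on $\mathcal{C}$ and it is the Heyting implication of $J_1$ and $J_2$ in the collection of Grothendieck topologies on $\mathcal{C}$ ordered by inclusion: for any Grothendieck topology $K$ on $\mathcal{C}$, $K\wedge J_1\leq J_2$ if and only if $K\leq (J_1\Rightarrow J_2)$. In particular, the pseudocomplement $\neg J$ of a Grothendieck topology $J$ on $\mathcal{C}$ is given by: $S\in\neg J(c)$ if and only if for any arrow $f:d\to c$ and sieve $Z$ on $d$, if $Z$ is $J$-covering and $f^{*}(S)\subseteq Z$ then $Z=M_d$.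
   Context: $M_d$ is the maximal sieve on $d$ and $f^{*}(S)=\{g\mid f\circ g\in S\}$. The order is $J\leq J'$ iff $J(c)\subseteq J'(c)$ for every object $c$; $K\wedge J$ is the intersection, $(K\wedge J)(c)=K(c)\cap J(c)$; the bottom topology has only maximal sieves as covering sieves. A sieve $Z$ on $d$ is $J$-closed if for every arrow $g:e\to d$, $g^{*}(Z)\in J(e)$ implies $g\in Z$. *)

(* Defs.v *)
From Stdlib Require Import FunctionalExtensionality PropExtensionality ProofIrrelevance.

Set Implicit Arguments.
Unset Strict Implicit.

Record Category := {
  Ob :> Type;
  Hom : Ob -> Ob -> Type;
  idm : forall c : Ob, Hom c c;
  comp : forall a b c : Ob, Hom b c -> Hom a b -> Hom a c;
  comp_idl : forall (a b : Ob) (f : Hom a b), comp (idm b) f = f;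
  comp_idr : forall (a b : Ob) (f : Hom a b), comp f (idm a) = f;
  comp_assoc : forall (a b c d : Ob) (h : Hom c d) (g : Hom b c) (f : Hom a b),
    comp h (comp g f) = comp (comp h g) f
}.

Notation "f \oc g" := (comp f g) (at level 40, left associativity).

Record Sieve (C : Category) (c : C) := {
  arrows :> forall d : C, Hom d c -> Prop;
  arrows_comp : forall (d e : C) (f : Hom d c) (g : Hom e d),
    arrows f -> arrows (f \oc g)
}.

Lemma sieve_ext (C : Category) (c : C) (S T : Sieve c) :
  (forall (d : C) (f : Hom d c), S d f <-> T d f) -> S = T.
Proof.
  destruct S as [s hs], T as [t ht]; simpl; intros H.
  assert (E : s = t).
  { extensionality d; extensionality f; apply propositional_extensionality; apply H. }
  subst t; f_equal; apply proof_irrelevance.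
Qed.

Definition sieve_sub (C : Category) (c : C) (S T : Sieve c) : Prop :=
  forall (d : C) (f : Hom d c), S d f -> T d f.

Definition max_sieve (C : Category) (c : C) : Sieve c :=
  {| arrows := fun (d : C) (_ : Hom d c) => True;
     arrows_comp := fun _ _ _ _ _ => I |}.

Lemma pullback_comp (C : Category) (c d : C) (f : Hom d c) (S : Sieve c)
    (e e' : C) (g : Hom e d) (h : Hom e' e) :
  S e (f \oc g) -> S e' (f \oc (g \oc h)).
Proof. intros H; rewrite comp_assoc; now apply arrows_comp. Qed.

Definition pullback (C : Category) (c d : C) (f : Hom d c) (S : Sieve c) : Sieve d :=
  {| arrows := fun (e : C) (g : Hom e d) => S e (f \oc g);
     arrows_comp := fun e e' g h => @pullback_comp C c d f S e e' g h |}.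

Definition SieveFamily (C : Category) := forall c : C, Sieve c -> Prop.

Record is_topology (C : Category) (J : SieveFamily C) : Prop := {
  top_max : forall c : C, J c (max_sieve c);
  top_stable : forall (c d : C) (f : Hom d c) (S : Sieve c),
    J c S -> J d (pullback f S);
  top_trans : forall (c : C) (S R : Sieve c),
    J c S ->
    (forall (d : C) (f : Hom d c), S d f -> J d (pullback f R)) ->
    J c R
}.

Record Topology (C : Category) := MkTopology {
  covers :> forall c : C, Sieve c -> Prop;
  coversP : is_topology covers
}.

Definition topology_le (C : Category) (J J' : Topology C) : Prop :=
  forall (c : C) (S : Sieve c), J c S -> J' c S.

Lemma meet_is_topology (C : Category) (K J : Topology C) :
  is_topology (fun (c : C) (S : Sieve c) => K c S /\ J c S).
Proof.
  split.
  - intros c; split; apply top_max, coversP.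
  - intros c d f S [HK HJ]; split; apply top_stable; trivial; apply coversP.
  - intros c S R [HK HJ] H; split.
    + apply (top_trans (coversP K) HK); intros d f Hf; now apply H.
    + apply (top_trans (coversP J) HJ); intros d f Hf; now apply H.
Qed.

Definition topology_meet (C : Category) (K J : Topology C) : Topology C :=
  MkTopology (meet_is_topology K J).

Lemma bottom_is_topology (C : Category) :
  is_topology (fun (c : C) (S : Sieve c) => S = max_sieve c).
Proof.
  split.
  - reflexivity.
  - intros c d f S ->; apply sieve_ext; intros e g; simpl; tauto.
  - intros c S R -> H; apply sieve_ext; intros d f; split; [now simpl|intros _].
    assert (HR : pullback f R d (idm d)) by now rewrite (H d f I).
    simpl in HR; now rewrite comp_idr in HR.
Qed.

Definition topology_bottom (C : Category) : Topology C :=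
  MkTopology (bottom_is_topology C).

Definition closed_sieve (C : Category) (J : Topology C) (d : C) (Z : Sieve d) : Prop :=
  forall (e : C) (g : Hom e d), J e (pullback g Z) -> Z e g.

Definition imp_family (C : Category) (J1 J2 : Topology C) : SieveFamily C :=
  fun (c : C) (S : Sieve c) =>
    forall (d : C) (f : Hom d c) (Z : Sieve d),
      J1 d Z -> closed_sieve J2 Z -> sieve_sub (pullback f S) Z ->
      Z = max_sieve d.

Definition neg_family (C : Category) (J : Topology C) : SieveFamily C :=
  fun (c : C) (S : Sieve c) =>
    forall (d : C) (f : Hom d c) (Z : Sieve d),
      J d Z -> sieve_sub (pullback f S) Z -> Z = max_sieve d.

Definition is_heyting_implication (C : Category) (J1 J2 H : Topology C) : Prop :=
  forall K : Topology C,
    topology_le (topology_meet K J1) J2 <-> topology_le K H.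

Definition is_pseudocomplement (C : Category) (J N : Topology C) : Prop :=
  is_heyting_implication J (topology_bottom C) N.

(* Main.v *)
Require Import Defs.
From Stdlib Require Import FunctionalExtensionality PropExtensionality.

Set Implicit Arguments.
Unset Strict Implicit.

(** If [K] meets [J1] inside [J2], a [J1]-covering and [J2]-closed sieve [Z]
    containing a [K]-covering sieve is [J2]-covering, hence maximal by closedness.
    Conversely, a [J1]-covering sieve [S] of the implication has a [J2]-closure
    which is [J1]-covering and [J2]-closed, hence maximal, so [S] is
    [J2]-covering. Negation is the case where [J2] is the bottom topology,
    for which every sieve is closed. *)

Lemma sieve_id_max (C : Category) (c : C) (S : Sieve c) :
  S c (idm c) -> S = max_sieve c.
Proof.
  intros H; apply sieve_ext; intros d f; split; [easy|intros _].
  rewrite <- (comp_idl f); now apply arrows_comp.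
Qed.

Lemma pullback_id (C : Category) (c : C) (S : Sieve c) :
  pullback (idm c) S = S.
Proof. apply sieve_ext; intros d f; simpl; now rewrite comp_idl. Qed.

Lemma pullback_pullback (C : Category) (c d e : C) (f : Hom d c) (g : Hom e d)
    (S : Sieve c) :
  pullback g (pullback f S) = pullback (f \oc g) S.
Proof. apply sieve_ext; intros a h; simpl; now rewrite comp_assoc. Qed.

Lemma pullback_mem (C : Category) (c d : C) (f : Hom d c) (S : Sieve c) :
  S d f -> pullback f S = max_sieve d.
Proof. intros H; apply sieve_id_max; simpl; now rewrite comp_idr. Qed.

(** Transitivity along [S]: the pullback of [T] along any arrow of [S] is maximal. *)
Lemma covers_up (C : Category) (J : Topology C) (c : C) (S T : Sieve c) :
  J c S -> sieve_sub S T -> J c T.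
Proof.
  intros HS HST; apply (top_trans (coversP J) HS); intros d f Hf.
  rewrite (pullback_mem (HST d f Hf)); apply top_max, coversP.
Qed.

Lemma closed_pullback (C : Category) (J : Topology C) (c d : C) (f : Hom d c)
    (Z : Sieve c) :
  closed_sieve J Z -> closed_sieve J (pullback f Z).
Proof.
  intros HZ e g Hg; rewrite pullback_pullback in Hg; exact (HZ e (f \oc g) Hg).
Qed.

Lemma closed_covers_max (C : Category) (J : Topology C) (c : C) (Z : Sieve c) :
  closed_sieve J Z -> J c Z -> Z = max_sieve c.
Proof.
  intros HZ HJ; apply sieve_id_max, HZ; now rewrite pullback_id.
Qed.

Lemma closure_comp (C : Category) (J : Topology C) (c : C) (S : Sieve c)
    (d e : C) (f : Hom d c) (g : Hom e d) :
  J d (pullback f S) -> J e (pullback (f \oc g) S).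
Proof.
  intros H; rewrite <- pullback_pullback; now apply (top_stable (coversP J)).
Qed.

(** The usual [J]-closure: the smallest [J]-closed sieve containing [S]. *)
Definition closure (C : Category) (J : Topology C) (c : C) (S : Sieve c) :
    Sieve c :=
  {| arrows := fun (d : C) (f : Hom d c) => J d (pullback f S);
     arrows_comp := @closure_comp C J c S |}.

Lemma closure_sub (C : Category) (J : Topology C) (c : C) (S : Sieve c) :
  sieve_sub S (closure J S).
Proof.
  intros d f Hf; simpl; rewrite (pullback_mem Hf); apply top_max, coversP.
Qed.

(** This is transitivity: if the closure pulls back along [f] to a covering sieve, then [S] pulls
    back to a covering sieve along [f \oc g] for each [g] in that sieve. *)
Lemma closure_closed (C : Category) (J : Topology C) (c : C) (S : Sieve c) :
  closed_sieve J (closure J S).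
Proof.
  intros d f Hf; apply (top_trans (coversP J) Hf); intros e g Hg.
  now rewrite pullback_pullback.
Qed.

Lemma closure_max_covers (C : Category) (J : Topology C) (c : C) (S : Sieve c) :
  closure J S = max_sieve c -> J c S.
Proof.
  intros H.
  assert (Hid : closure J S c (idm c)) by now rewrite H.
  simpl in Hid; now rewrite pullback_id in Hid.
Qed.

Lemma imp_is_topology (C : Category) (J1 J2 : Topology C) :
  is_topology (imp_family J1 J2).
Proof.
  split.
  - intros c d f Z _ _ HZ; apply sieve_id_max, HZ; exact I.
  - intros c d f S HS e g Z H1 H2 HZ.
    rewrite pullback_pullback in HZ; exact (HS e (f \oc g) Z H1 H2 HZ).
  - intros c S R HS HR d f Z H1 H2 HZ.
    (* Testing [S] against the same [Z] leaves only the inclusion of [pullback f S] in [Z]. *)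
    apply (HS d f Z H1 H2); intros e g Hg.
    assert (E : pullback g Z = max_sieve e).
    (* The covering property of [pullback (f \oc g) R] is tested at the identity against
       [pullback g Z], which is still [J1]-covering and [J2]-closed. *)
    { apply (HR e (f \oc g) Hg e (idm e)).
      - now apply (top_stable (coversP J1)).
      - now apply closed_pullback.
      - rewrite pullback_id, <- pullback_pullback.
        intros a h; exact (HZ a (g \oc h)). }
    assert (Hid : pullback g Z e (idm e)) by now rewrite E.
    simpl in Hid; now rewrite comp_idr in Hid.
Qed.

Lemma imp_is_heyting (C : Category) (J1 J2 : Topology C) :
  is_heyting_implication J1 J2 (MkTopology (imp_is_topology J1 J2)).
Proof.
  intros K; split.
  - intros HK c S HS d f Z H1 H2 HZ.
    apply (closed_covers_max H2), HK; split; [|exact H1].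
    apply (covers_up (S := pullback f S)); [|exact HZ].
    now apply (top_stable (coversP K)).
  - intros HK c S [HS H1]; apply closure_max_covers.
    (* The test sieve is the [J2]-closure of [S], taken over the identity; it is [J1]-covering
       because it contains [S]. *)
    apply (HK c S HS c (idm c)).
    + exact (covers_up H1 (@closure_sub C J2 c S)).
    + apply closure_closed.
    + rewrite pullback_id; apply closure_sub.
Qed.

Lemma closed_bottom (C : Category) (c : C) (Z : Sieve c) :
  closed_sieve (topology_bottom C) Z.
Proof.
  intros d f E; simpl in E.
  assert (Hid : pullback f Z d (idm d)) by now rewrite E.
  simpl in Hid; now rewrite comp_idr in Hid.
Qed.

(** Stated as an equality of families so that rewriting transfers both the topology axioms and the
    universal property to the negation. *)
Lemma neg_imp_bottom (C : Category) (J : Topology C) :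
  neg_family J = imp_family J (topology_bottom C).
Proof.
  extensionality c; extensionality S; apply propositional_extensionality.
  split; intros H d f Z HJ.
  - intros _; now apply H.
  - exact (H d f Z HJ (@closed_bottom C d Z)).
Qed.

Theorem mainTheorem4 (C : Category) :
  (forall J1 J2 : Topology C,
     exists H : is_topology (imp_family J1 J2),
       is_heyting_implication J1 J2 (MkTopology H)) /\
  (forall J : Topology C,
     exists H : is_topology (neg_family J),
       is_pseudocomplement J (MkTopology H)).
Proof.
  split.
  - intros J1 J2; exists (imp_is_topology J1 J2); apply imp_is_heyting.
  - intros J; rewrite neg_imp_bottom.
    exists (imp_is_topology J (topology_bottom C)); apply imp_is_heyting.
Qed.
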